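(* Let $t\ge2$. The algebra homomorphism $\rho:H_t(-q)\to\mathcal{C}_t^{\frac12}$ defined by $\rho:g_j\mapsto i^{\,1-\pi/2\phi}q^{3/4}\check R_j$ ($1\le j\le t-1$) yields a representation of the Hecke algebra $H_t(-q)$ (that is, this assignment extends to a well-defined algebra homomorphism). Here $\mathcal{C}_t^{\frac12}$ is the subalgebra of $\mathrm{End}_{U_q(osp(1|2))}\big[(V^+_{1/2})^{\otimes t}\big]$ generated by $\check R_j^{\pm1}=\mathrm{id}^{\otimes(j-1)}\otimes\check{\mathcal R}_{\frac12\frac12}^{\pm1}\otimes\mathrm{id}^{\otimes(t-j-1)}$, $1\le j\le t-1$.
   Context: **Hecke algebra.** For a complex number $p$, $H_t(p)$ is the unital associative $\mathbb{C}$-algebra generated by $g_1,\dots,g_{t-1}$ with relations $g_jg_{j+1}g_j=g_{j+1}g_jg_{j+1}$ ($1\le j\le t-2$), $g_jg_k=g_kg_j$ ($|j-k|>1$), $g_j^2=(p-1)g_j+p$ ($1\le j\le t-1$). $H_t(-q)$ is the case $p=-q$. **$U_q(osp(1|2))$.** Let $q\in\mathbb{C}$ be nonzero and not a root of unity. $U_q(osp(1|2))$ is the unital associative $\mathbb{Z}_2$-graded $\mathbb{C}$-algebra generated by odd $e,f$ and even $K^{\pm1}$ with $ef+fe=(K-K^{-1})/(q-q^{-1})$, $KeK^{-1}=qe$, $KfK^{-1}=q^{-1}f$, $KK^{-1}=K^{-1}K=1$, and coproduct $\Delta(e)=e\otimes K+1\otimes e$, $\Delta(f)=f\otimes1+K^{-1}\otimes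 f$, $\Delta(K^{\pm1})=K^{\pm1}\otimes K^{\pm1}$. Tensor products obey $(a\otimes b)(v\otimes w)=(-1)^{[b][v]}av\otimes bw$, where $[\cdot]$ denotes the $\mathbb{Z}_2$-grading. **Conventions for powers.** Write $q=e^{i\phi}$ with $\phi\in\mathbb{C}$, $i=\sqrt{-1}$; $q^a=e^{ia\phi}$, and $i^z=e^{i\pi z/2}$, for complex $a,z$; $\pi/2\phi$ means $\pi/(2\phi)$. **The module.** $V^+_{1/2}$ is the two-dimensional irreducible module with even highest weight vector $v_+$ satisfying $ev_+=0$, $Kv_+=iq^{1/2}v_+$; basis $v_{1/2}=v_+$ (even), $v_{-1/2}=fv_+$ (odd). Let $\pi_{1/2}$ be its representation. **The braiding.** Let $\widetilde R^V=1\otimes1+(q^{-1}-q)(e\otimes f)$, $\mathcal{E}(v_j\otimes v_k)=q^{(j+\pi/2\phi)(k+\pi/2\phi)}v_j\otimes v_k$ for $j,k\in\{1/2,-1/2\}$, $P(v\otimes w)=(-1)^{[v][w]}w\otimes v$, and $\check{\mathcal R}_{\frac12\frac12}=P\circ\mathcal{E}\circ(\pi_{1/2}\otimes\pi_{1/2})(\widetilde R^V)$. It is an invertible $U_q(osp(1|2))$-linear map; in the ordered basis $v_{1/2}\otimes v_{1/2},\,v_{1/2}\otimes v_{-1/2},\,v_{-1/2}\otimes v_{1/2},\,v_{-1/2}\otimes v_{-1/2}$ it is $$i^{\pi/2\phi}\begin{pmatrix} iq^{1/4}&0&0&0\\0&0&q^{-1/4}&0\\0&q^{-1/4}&i(q^{1/4}+q^{-3/4})&0\\0&0&0&iq^{1/4}\end{pmatrix}.$$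 *)

(* Defs.v *)
From HB Require Import structures.
From mathcomp Require Import all_boot all_order all_algebra.
From mathcomp Require Import complex mxtens.
From mathcomp Require Import boolp classical_sets reals sequences exp trigo.
From mathcomp Require Import ring.

Set Implicit Arguments.
Unset Strict Implicit.
Unset Printing Implicit Defensive.

Import Order.TTheory GRing.Theory Num.Theory.
Local Open Scope ring_scope.
Local Open Scope quotient_scope.
Local Open Scope classical_set_scope.

Section Presentation.
Variable C : fieldType.

Inductive term (X : Type) : Type :=
| TGen of X
| TCst of C
| TAdd of term X & term X
| TMul of term X & term X.

Fixpoint eval (X : Type) (A : pzRingType) (iota : C -> A) (a : X -> A)
    (r : term X) : A :=
  match r with
  | TGen x => a x
  | TCst c => iota c
  | TAdd r s => eval iota a r + eval iota a s
  | TMul r s => eval iota a r * eval iota a s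
  end.

(* In MathComp an [algType] satisfies 1 != 0 by definition, so a presentation
   comes with the existence of a one-dimensional representation. *)
Record presentation := Presentation {
  pgen : Type;
  prel : term pgen -> term pgen -> Prop;
  paug : exists chi : pgen -> C,
    forall r s, prel r s -> eval idfun chi r = eval idfun chi s }.

Variable P : presentation.
Local Notation T := (term (pgen P)).

(* [palg] below is the quotient of [term] by the least congruence that contains
   the relations and makes the quotient a unital associative C-algebra. *)
Inductive cong : T -> T -> Prop :=
| cong_rel r s : prel r s -> cong r s
| cong_refl r : cong r r
| cong_sym r s : cong r s -> cong s r
| cong_trans s r u : cong r s -> cong s u -> cong r u
| cong_add r r' s s' : cong r r' -> cong s s' -> cong (TAdd r s) (TAdd r' s')
| cong_mul r r' s s' : cong r r' -> cong s s' -> cong (TMul r s) (TMul r' s')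
| cong_addA r s u : cong (TAdd r (TAdd s u)) (TAdd (TAdd r s) u)
| cong_addC r s : cong (TAdd r s) (TAdd s r)
| cong_add0 r : cong (TAdd (TCst _ 0) r) r
| cong_addN r : cong (TAdd (TMul (TCst _ (-1)) r) r) (TCst _ 0)
| cong_mulA r s u : cong (TMul r (TMul s u)) (TMul (TMul r s) u)
| cong_mul1l r : cong (TMul (TCst _ 1) r) r
| cong_mul1r r : cong (TMul r (TCst _ 1)) r
| cong_mulDl r s u : cong (TMul (TAdd r s) u) (TAdd (TMul r u) (TMul s u))
| cong_mulDr r s u : cong (TMul r (TAdd s u)) (TAdd (TMul r s) (TMul r u))
| cong_cstD a b : cong (TCst _ (a + b)) (TAdd (TCst _ a) (TCst _ b))
| cong_cstM a b : cong (TCst _ (a * b)) (TMul (TCst _ a) (TCst _ b))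
| cong_cstC a r : cong (TMul (TCst _ a) r) (TMul r (TCst _ a)).

HB.instance Definition _ := gen_eqMixin T.
HB.instance Definition _ := gen_choiceMixin T.

Definition congb (r s : T) : bool := `[< cong r s >].

Lemma congb_equiv : equiv_class_of congb.
Proof.
split=> [r|r s|s r u]; first by apply/asboolP; exact: cong_refl.
  by apply/asboolP/asboolP; exact: cong_sym.
by move=> /asboolP rs /asboolP su; apply/asboolP; exact: cong_trans rs su.
Qed.

Canonical congb_equiv_rel := EquivRelPack congb_equiv.

Definition palg := {eq_quot congb}.
HB.instance Definition _ := Choice.on palg.

Definition pi_palg (r : T) : palg := \pi_{eq_quot congb} r.

Lemma pi_palgP r s : pi_palg r = pi_palg s <-> cong r s.
Proof.
split; first by move=> /eqquotP/asboolP.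
by move=> rs; apply/eqquotP/asboolP.
Qed.

Lemma pi_repr x : pi_palg (repr x) = x. Proof. exact: reprK. Qed.

Lemma repr_pi r : cong (repr (pi_palg r)) r.
Proof. by apply/pi_palgP; rewrite pi_repr. Qed.

Definition pgenerator (x : pgen P) : palg := pi_palg (TGen x).
Definition pcst (c : C) : palg := pi_palg (TCst _ c).
Definition padd (x y : palg) : palg := pi_palg (TAdd (repr x) (repr y)).
Definition pmul (x y : palg) : palg := pi_palg (TMul (repr x) (repr y)).
Definition popp (x : palg) : palg := pmul (pcst (-1)) x.

Lemma paddE r s : padd (pi_palg r) (pi_palg s) = pi_palg (TAdd r s).
Proof. by apply/pi_palgP; apply: cong_add; exact: repr_pi. Qed.

Lemma pmulE r s : pmul (pi_palg r) (pi_palg s) = pi_palg (TMul r s).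
Proof. by apply/pi_palgP; apply: cong_mul; exact: repr_pi. Qed.

Let palgW (Q : palg -> Prop) : (forall r, Q (pi_palg r)) -> forall x, Q x.
Proof. by move=> H x; rewrite -(pi_repr x). Qed.

Let paddA : associative padd.
Proof.
elim/palgW=> r; elim/palgW=> s; elim/palgW=> u.
rewrite !paddE; apply/pi_palgP; exact: cong_addA.
Qed.

Let paddC : commutative padd.
Proof.
elim/palgW=> r; elim/palgW=> s; rewrite !paddE; apply/pi_palgP.
exact: cong_addC.
Qed.

Let padd0 : left_id (pcst 0) padd.
Proof. by elim/palgW=> r; rewrite !paddE; apply/pi_palgP; exact: cong_add0. Qed.

Let paddN : left_inverse (pcst 0) popp padd.
Proof.
by elim/palgW=> r; rewrite /popp pmulE paddE; apply/pi_palgP; exact: cong_addN.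
Qed.

HB.instance Definition _ := GRing.isZmodule.Build palg paddA paddC padd0 paddN.

Let pmulA : associative pmul.
Proof.
elim/palgW=> r; elim/palgW=> s; elim/palgW=> u.
rewrite !pmulE; apply/pi_palgP; exact: cong_mulA.
Qed.

Let pmul1l : left_id (pcst 1) pmul.
Proof. by elim/palgW=> r; rewrite !pmulE; apply/pi_palgP; exact: cong_mul1l. Qed.

Let pmul1r : right_id (pcst 1) pmul.
Proof. by elim/palgW=> r; rewrite !pmulE; apply/pi_palgP; exact: cong_mul1r. Qed.

Let pmulDl : left_distributive pmul padd.
Proof.
elim/palgW=> r; elim/palgW=> s; elim/palgW=> u.
rewrite !(pmulE, paddE); apply/pi_palgP; exact: cong_mulDl.
Qed.

Let pmulDr : right_distributive pmul padd.
Proof.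
elim/palgW=> r; elim/palgW=> s; elim/palgW=> u.
rewrite !(pmulE, paddE); apply/pi_palgP; exact: cong_mulDr.
Qed.

Lemma cong_eval (A : pzRingType) (iota : {rmorphism C -> A}) (a : pgen P -> A) :
  (forall c x, iota c * x = x * iota c) ->
  (forall r s, prel r s -> eval iota a r = eval iota a s) ->
  forall r s, cong r s -> eval iota a r = eval iota a s.
Proof.
move=> iC rP r s; elim=> {r s} //=.
- by move=> r s u _ -> _ ->.
- by move=> r r' s s' _ -> _ ->.
- by move=> r r' s s' _ -> _ ->.
- by move=> r s u; rewrite addrA.
- by move=> r s; rewrite addrC.
- by move=> r; rewrite rmorph0 add0r.
- by move=> r; rewrite rmorphN1 rmorph0 mulN1r addNr.
- by move=> r s u; rewrite mulrA.
- by move=> r; rewrite rmorph1 mul1r.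
- by move=> r; rewrite rmorph1 mulr1.
- by move=> r s u; rewrite mulrDl.
- by move=> r s u; rewrite mulrDr.
- by move=> b c; rewrite rmorphD.
- by move=> b c; rewrite rmorphM.
Qed.

Let palg1_neq0 : pcst 1 != 0.
Proof.
apply/eqP => /pi_palgP H; have [chi chiP] := paug P.
have /= := @cong_eval C idfun chi (fun c x => mulrC _ _) chiP _ _ H.
by apply/eqP; exact: oner_neq0.
Qed.

HB.instance Definition _ := GRing.Zmodule_isNzRing.Build palg
  pmulA pmul1l pmul1r pmulDl pmulDr palg1_neq0.

Definition pscale (c : C) (x : palg) : palg := pcst c * x.

Let pcstM a b : pcst (a * b) = pcst a * pcst b.
Proof. by apply/esym; rewrite [LHS]pmulE; apply/esym/pi_palgP/cong_cstM. Qed.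

Let pcstD a b : pcst (a + b) = pcst a + pcst b.
Proof. by apply/esym; rewrite [LHS]paddE; apply/esym/pi_palgP/cong_cstD. Qed.

Let pcstC a x : pcst a * x = x * pcst a.
Proof.
elim/palgW: x => r; rewrite [LHS]pmulE [RHS]pmulE; apply/pi_palgP.
exact: cong_cstC.
Qed.

Let pscaleA a b x : pscale a (pscale b x) = pscale (a * b) x.
Proof. by rewrite /pscale mulrA pcstM. Qed.

Let pscale1 : left_id 1 pscale.
Proof. by move=> x; rewrite /pscale mul1r. Qed.

Let pscaleDr : right_distributive pscale +%R.
Proof. by move=> a x y; rewrite /pscale mulrDr. Qed.

Let pscaleDl x : {morph pscale^~ x : a b / a + b}.
Proof. by move=> a b; rewrite /pscale pcstD mulrDl. Qed.

HB.instance Definition _ := GRing.Zmodule_isLmodule.Build C palg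
  pscaleA pscale1 pscaleDr pscaleDl.

Let pscaleAl (a : C) (x y : palg) : a *: (x * y) = (a *: x) * y.
Proof. exact: mulrA. Qed.

HB.instance Definition _ := GRing.Lmodule_isLalgebra.Build C palg pscaleAl.

Let pscaleAr (a : C) (x y : palg) : a *: (x * y) = x * (a *: y).
Proof. by rewrite [LHS]mulrA pcstC -mulrA. Qed.

HB.instance Definition _ := GRing.Lalgebra_isAlgebra.Build C palg pscaleAr.

Lemma pgenerator_rel r s : prel r s ->
  eval (fun c => c%:A) pgenerator r = eval (fun c => c%:A) pgenerator s.
Proof.
suff evalE (u : T) : eval (fun c => c%:A) pgenerator u = pi_palg u.
  by move=> rs; rewrite !evalE; apply/pi_palgP; exact: cong_rel.
elim: u => [x|c|u IHu v IHv|u IHu v IHv] //=.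
- exact: mulr1.
- by rewrite IHu IHv; exact: paddE.
- by rewrite IHu IHv; exact: pmulE.
Qed.

Section MatrixRepresentation.
Variables (n : nat) (a : pgen P -> 'M[C]_n).
Hypothesis aP : forall r s, prel r s ->
  eval (@scalar_mx C n) a r = eval (@scalar_mx C n) a s.

Definition plift of
    (forall r s, prel r s ->
       eval (@scalar_mx C n) a r = eval (@scalar_mx C n) a s) :=
  fun x : palg => eval (@scalar_mx C n) a (repr x).

Local Notation f := (plift aP).

Let fE r : f (pi_palg r) = eval (@scalar_mx C n) a r.
Proof.
apply: (@cong_eval 'M[C]_n (@scalar_mx C n) a) => //; last exact: repr_pi.
by move=> c x; exact: (esym (scalar_mxC c x)).
Qed.

Let fD : {morph f : x y / x + y}.
Proof.
by elim/palgW=> r; elim/palgW=> s; rewrite [X in f X]paddE !fE.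
Qed.

Let fM : {morph f : x y / x * y}.
Proof.
by elim/palgW=> r; elim/palgW=> s; rewrite [X in f X]pmulE !fE.
Qed.

Let f1 : f 1 = 1. Proof. by rewrite [LHS]fE. Qed.

Let fZ : scalable f.
Proof.
by move=> c x; rewrite [X in f X]/(pcst c * x) fM [f (pcst c)]fE /= -mul_scalar_mx.
Qed.

Let fB : zmod_morphism f.
Proof. by move=> x y; rewrite fD -scaleN1r fZ scaleN1r. Qed.

HB.instance Definition _ := GRing.isZmodMorphism.Build palg 'M[C]_n f fB.
HB.instance Definition _ := GRing.isMonoidMorphism.Build palg 'M[C]_n f (f1, fM).
HB.instance Definition _ := GRing.isScalable.Build C palg 'M[C]_n *:%R f fZ.

Definition prep : {lrmorphism palg -> 'M[C]_n} := f.

Lemma prepE x : prep (pgenerator x) = a x. Proof. exact: fE. Qed.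

End MatrixRepresentation.
End Presentation.

Arguments TGen {C X} x.
Arguments TCst {C X} c.

Declare Scope term_scope.
Delimit Scope term_scope with term.
Bind Scope term_scope with term.
Notation "r + s" := (TAdd r s) : term_scope.
Notation "r * s" := (TMul r s) : term_scope.
Notation "r - s" := (TAdd r (TMul (TCst (-1)) s)) : term_scope.

Section Hecke.
Variables (C : fieldType) (t : nat) (p : C).

Local Notation g j := (@TGen C _ j).

(* The generator g_(j+1) of the text is indexed by j : 'I_t.-1. *)
Inductive hecke_rel : term C 'I_t.-1 -> term C 'I_t.-1 -> Prop :=
| hecke_braid (j k : 'I_t.-1) : k = j.+1 :> nat ->
    hecke_rel (g j * g k * g j)%term (g k * g j * g k)%term
| hecke_comm (j k : 'I_t.-1) : (j.+1 < k)%N || (k.+1 < j)%N ->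
    hecke_rel (g j * g k)%term (g k * g j)%term
| hecke_quad (j : 'I_t.-1) :
    hecke_rel (g j * g j)%term (TCst (p - 1)%R * g j + TCst p)%term.

Lemma hecke_aug : exists chi : 'I_t.-1 -> C,
  forall r s, hecke_rel r s -> eval idfun chi r = eval idfun chi s.
Proof.
by exists (fun=> -1) => r s [j k _|j k _|j] //=; rewrite !mulrN1 opprK opprB subrK.
Qed.

Definition hecke := palg (Presentation hecke_aug).
HB.instance Definition _ := GRing.Algebra.on hecke.

Definition hecke_gen (j : 'I_t.-1) : hecke :=
  @pgenerator C (Presentation hecke_aug) j.

End Hecke.

Section ComplexPowers.
Variable R : realType.
Local Notation C := R[i].

Definition cexp (z : C) : C :=
  (expR (complex.Re z))%:C%C * (cos (complex.Im z) +i* sin (complex.Im z))%C.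

(* i^z = e^(i pi z / 2) *)
Definition ipow (z : C) : C := cexp ('i * (pi : R)%:C%C * z / 2).

(* q^a = e^(i a phi), where q = e^(i phi) *)
Definition qpow (phi a : C) : C := cexp ('i * a * phi).

Definition qpar (phi : C) : C := cexp ('i * phi).

Lemma cexpD z w : cexp (z + w) = cexp z * cexp w.
Proof.
case: z w => [a b] [c d]; rewrite /cexp /= expRD cosD sinD.
by apply/eqP; rewrite eq_complex /=; apply/andP; split; apply/eqP; ring.
Qed.

Lemma cexp0 : cexp 0 = 1.
Proof.
by rewrite /cexp /= expR0 cos0 sin0 mul1r.
Qed.

Lemma cexp_neq0 z : cexp z != 0.
Proof.
apply/eqP => z0; have := cexp0; rewrite -(subrr z) cexpD z0 mul0r => /esym/eqP.
by rewrite oner_eq0.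
Qed.

End ComplexPowers.

Variant ugen := Ue | Uf | UK | UKinv.

Section Uq.
Variables (R : realType) (phi : R[i]).
Local Notation C := R[i].
Local Notation q := (qpar phi).
Local Notation g x := (@TGen C _ x).

Inductive uq_rel : term C ugen -> term C ugen -> Prop :=
| uq_ef : uq_rel (g Ue * g Uf + g Uf * g Ue)%term
                 (TCst (q - q^-1)^-1%R * (g UK - g UKinv))%term
| uq_Ke : uq_rel (g UK * g Ue * g UKinv)%term (TCst q * g Ue)%term
| uq_Kf : uq_rel (g UK * g Uf * g UKinv)%term (TCst q^-1%R * g Uf)%term
| uq_KKinv : uq_rel (g UK * g UKinv)%term (TCst 1)
| uq_KinvK : uq_rel (g UKinv * g UK)%term (TCst 1).

Lemma uq_aug : exists chi : ugen -> C,
  forall r s, uq_rel r s -> eval idfun chi r = eval idfun chi s.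
Proof.
exists (fun x => match x with Ue | Uf => 0 | UK | UKinv => 1 end).
by move=> r s [] /=; rewrite ?(mulr0, mul0r, mulr1, addr0, subrr).
Qed.

Definition uq := palg (Presentation uq_aug).
HB.instance Definition _ := GRing.Algebra.on uq.

Definition uq_gen (x : ugen) : uq := @pgenerator C (Presentation uq_aug) x.

Definition ugen_par (x : ugen) : bool :=
  match x with Ue | Uf => true | UK | UKinv => false end.

Definition homogeneous n (par : 'I_n -> bool) (b : bool) (A : 'M[C]_n) :=
  forall i j, A i j != 0 -> par i (+) par j = b.

(* A graded module on C^n, whose standard basis is homogeneous: the i-th basis
   vector has degree [smod_par i].  Matrices act on column vectors. *)
Record smod (n : nat) := SMod {
  smod_par : 'I_n -> bool;
  smod_act : {lrmorphism uq -> 'M[C]_n};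
  smod_homo : forall x, homogeneous smod_par (ugen_par x) (smod_act (uq_gen x)) }.

Section BuildModule.
Variables (n : nat) (par : 'I_n -> bool) (e f k ki : 'M[C]_n).
Let ops (x : ugen) : 'M[C]_n :=
  match x with Ue => e | Uf => f | UK => k | UKinv => ki end.
Hypothesis ef : e *m f + f *m e = (q - q^-1)^-1 *: (k - ki).
Hypothesis ke : k *m e *m ki = q *: e.
Hypothesis kf : k *m f *m ki = q^-1 *: f.
Hypothesis kki : k *m ki = 1%:M.
Hypothesis kik : ki *m k = 1%:M.
Hypothesis homo : forall x, homogeneous par (ugen_par x) (ops x).

Let opsP r s : uq_rel r s ->
  eval (@scalar_mx C n) ops r = eval (@scalar_mx C n) ops s.
Proof.
case=> /=; rewrite -?mulmxE ?mul_scalar_mx ?scaleN1r //.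
Qed.

Let homo_prep x : homogeneous par (ugen_par x) (@prep C (Presentation uq_aug) n ops opsP (uq_gen x)).
Proof. by rewrite prepE. Qed.

Definition mk_smod : smod n := SMod homo_prep.

Lemma mk_smodE x : smod_act mk_smod (uq_gen x) = ops x.
Proof. exact: prepE. Qed.

End BuildModule.

Lemma q_neq0 : q != 0. Proof. exact: cexp_neq0. Qed.

(* The operator v |-> (-1)^(b [v]) v. *)
Definition sgn_op n (par : 'I_n -> bool) (b : bool) : 'M[C]_n :=
  diag_mx (\row_i (-1) ^+ (b && par i)).

(* A (x) B for B homogeneous of degree b, acting on v (x) w by
   (A (x) B)(v (x) w) = (-1)^(b [v]) A v (x) B w. *)
Definition stens m n (par : 'I_m -> bool) (b : bool) (A : 'M[C]_m) (B : 'M[C]_n)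
  : 'M[C]_(m * n) := (A *m sgn_op par b) *t B.

Lemma sgn_op0 n (par : 'I_n -> bool) : sgn_op par false = 1%:M.
Proof. by rewrite -diag_const_mx; congr diag_mx; apply/rowP => i; rewrite !mxE. Qed.

Lemma sgn_opK n (par : 'I_n -> bool) b : sgn_op par b *m sgn_op par b = 1%:M.
Proof.
rewrite mul_diag_mx; apply/matrixP => i j; rewrite !mxE.
by case: (b && par i); case: (i == j); rewrite ?mulr0n ?mulr1n ?mulr0 ?mulr1 ?mulrNN ?mul1r.
Qed.

Lemma sgn_op_comm n (par : 'I_n -> bool) b (A : 'M[C]_n) :
  homogeneous par b A -> sgn_op par true *m A = (-1) ^+ b *: (A *m sgn_op par true).
Proof.
move=> hA; rewrite mul_diag_mx mul_mx_diag; apply/matrixP => i j; rewrite !mxE.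
have [->|/hA <-] := eqVneq (A i j) 0; first by rewrite !(mulr0, mul0r).
by case: (par i); case: (par j); rewrite /= ?expr1 ?expr0; ring.
Qed.

Section TensorModule.
Variables (m n : nat) (V : smod m) (W : smod n).
Local Notation v x := (smod_act V (uq_gen x)).
Local Notation w x := (smod_act W (uq_gen x)).
Local Notation tens b A B := (stens (smod_par V) b A B).

Definition tens_par (i : 'I_(m * n)) : bool :=
  smod_par V (mxtens_unindex i).1 (+) smod_par W (mxtens_unindex i).2.

(* The coproduct:  e |-> e (x) K + 1 (x) e,  f |-> f (x) 1 + K^-1 (x) f,
   K^(+-1) |-> K^(+-1) (x) K^(+-1). *)
Definition tens_e := tens false (v Ue) (w UK) + tens true 1%:M (w Ue).
Definition tens_f := tens false (v Uf) 1%:M + tens true (v UKinv) (w Uf).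
Definition tens_k := tens false (v UK) (w UK).
Definition tens_ki := tens false (v UKinv) (w UKinv).

End TensorModule.

Section SmodRelations.
Variables (n : nat) (V : smod n).
Local Notation v x := (smod_act V (uq_gen x)).

Let rel r s : uq_rel r s ->
  smod_act V (eval (fun c : C => c%:A) uq_gen r) =
  smod_act V (eval (fun c : C => c%:A) uq_gen s).
Proof. by move=> rs; congr (smod_act V _); exact: (@pgenerator_rel C (Presentation uq_aug)). Qed.

Lemma smod_ef : v Ue *m v Uf + v Uf *m v Ue = (q - q^-1)^-1 *: (v UK - v UKinv).
Proof.
by have := rel uq_ef; rewrite /= !(mulr_algl, scaleN1r) linearD /= linearZ /= linearB /= !rmorphM.
Qed.

Lemma smod_ke : v UK *m v Ue *m v UKinv = q *: v Ue.
Proof. by have := rel uq_Ke; rewrite /= !mulr_algl linearZ /= !rmorphM. Qed.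

Lemma smod_kf : v UK *m v Uf *m v UKinv = q^-1 *: v Uf.
Proof. by have := rel uq_Kf; rewrite /= !mulr_algl linearZ /= !rmorphM. Qed.

Lemma smod_kki : v UK *m v UKinv = 1%:M.
Proof. by have := rel uq_KKinv; rewrite /= scale1r rmorph1 rmorphM. Qed.

Lemma smod_kik : v UKinv *m v UK = 1%:M.
Proof. by have := rel uq_KinvK; rewrite /= scale1r rmorph1 rmorphM. Qed.

End SmodRelations.

Section TensorBilinear.
Variables (a b c d : nat).
Implicit Types (A : 'M[C]_(a, b)) (B : 'M[C]_(c, d)).

Lemma tensDl A A' B : (A + A') *t B = A *t B + A' *t B.
Proof. by apply/matrixP => i j; rewrite !mxE mulrDl. Qed.

Lemma tensDr A B B' : A *t (B + B') = A *t B + A *t B'.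
Proof. by apply/matrixP => i j; rewrite !mxE mulrDr. Qed.

Lemma tensZl x A B : (x *: A) *t B = x *: (A *t B).
Proof. by apply/matrixP => i j; rewrite !mxE mulrA. Qed.

Lemma tensZr x A B : A *t (x *: B) = x *: (A *t B).
Proof. by apply/matrixP => i j; rewrite !mxE mulrCA. Qed.

Lemma tensNl A B : (- A) *t B = - (A *t B).
Proof. by rewrite -scaleN1r tensZl scaleN1r. Qed.

Lemma tensNr A B : A *t (- B) = - (A *t B).
Proof. by rewrite -scaleN1r tensZr scaleN1r. Qed.

End TensorBilinear.

Section TensorModuleProofs.
Variables (m n : nat) (V : smod m) (W : smod n).
Local Notation v x := (smod_act V (uq_gen x)).
Local Notation w x := (smod_act W (uq_gen x)).
Local Notation S := (sgn_op (smod_par V) true).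

Let S2 : S *m S = 1%:M. Proof. exact: sgn_opK. Qed.
Let Se : S *m v Ue = - (v Ue *m S).
Proof. by rewrite (sgn_op_comm (@smod_homo _ V Ue)) expr1 scaleN1r. Qed.
Let Sf : S *m v Uf = - (v Uf *m S).
Proof. by rewrite (sgn_op_comm (@smod_homo _ V Uf)) expr1 scaleN1r. Qed.
Let Ski : S *m v UKinv = v UKinv *m S.
Proof. by rewrite (sgn_op_comm (@smod_homo _ V UKinv)) expr0 scale1r. Qed.
Let Sk : S *m v UK = v UK *m S.
Proof. by rewrite (sgn_op_comm (@smod_homo _ V UK)) expr0 scale1r. Qed.

Let eE : tens_e V W = v Ue *t w UK + S *t w Ue.
Proof. by rewrite /tens_e /stens sgn_op0 mulmx1 mul1mx. Qed.
Let fE : tens_f V W = v Uf *t 1%:M + (v UKinv *m S) *t w Uf.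
Proof. by rewrite /tens_f /stens sgn_op0 mulmx1. Qed.
Let kE : tens_k V W = v UK *t w UK.
Proof. by rewrite /tens_k /stens sgn_op0 mulmx1. Qed.
Let kiE : tens_ki V W = v UKinv *t w UKinv.
Proof. by rewrite /tens_ki /stens sgn_op0 mulmx1. Qed.

Let kiK k (U : smod k) : smod_act U (uq_gen UKinv) *m smod_act U (uq_gen Ue) =
  q^-1 *: (smod_act U (uq_gen Ue) *m smod_act U (uq_gen UKinv)).
Proof.
set ki := smod_act U (uq_gen UKinv); set e := smod_act U (uq_gen Ue).
have /(congr1 (mulmx ki)) := smod_ke U.
rewrite !mulmxA smod_kik mul1mx -/ki -/e -scalemxAr => ->.
by rewrite scalerA mulVf ?scale1r ?q_neq0.
Qed.

Let kK k (U : smod k) : smod_act U (uq_gen UK) *m smod_act U (uq_gen Uf) =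
  q^-1 *: (smod_act U (uq_gen Uf) *m smod_act U (uq_gen UK)).
Proof.
have /(congr1 (mulmx^~ (smod_act U (uq_gen UK)))) := smod_kf U.
by rewrite -!mulmxA smod_kik mulmx1 -scalemxAl.
Qed.

Let tens1 : (1%:M : 'M[C]_m) *t (1%:M : 'M[C]_n) = 1%:M.
Proof.
apply/matrixP=> i j; case: (mxtens_indexP i) => i0 i1; case: (mxtens_indexP j) => j0 j1.
by rewrite tensmxE !mxE (can_eq (@mxtens_indexK m n)) xpair_eqE -natrM mulnb.
Qed.

Let zmodE (Z : zmodType) (a b c d a' d' : Z) :
  a + b + (- c + d) + (a' + c + (- b + d')) = a + a' + (d + d').
Proof. by rewrite addrACA [a + b + _]addrACA [- c + d + _]addrACA -opprD [c + b]addrC -addrA addNKr. Qed.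

Lemma tens_ef : tens_e V W *m tens_f V W + tens_f V W *m tens_e V W =
  (q - q^-1)^-1 *: (tens_k V W - tens_ki V W).
Proof.
rewrite eE fE kE kiE !(mulmxDl, mulmxDr) !tensmx_mul !mulmx1 !mul1mx.
have SkiS : S *m (v UKinv *m S) = v UKinv by rewrite mulmxA Ski -mulmxA S2 mulmx1.
have kiSS : v UKinv *m S *m S = v UKinv by rewrite -mulmxA S2 mulmx1.
have kiSe : v UKinv *m S *m v Ue = - (q^-1 *: (v Ue *m (v UKinv *m S))).
  by rewrite -mulmxA Se mulmxN !mulmxA kiK -scalemxAl.
rewrite SkiS kiSS kiSe Sf kK tensZr !tensNl tensZl.
rewrite zmodE -tensDl -tensDr !smod_ef tensZl tensZr -scalerDr.
by rewrite tensDl tensDr tensNl tensNr addrA subrK.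
Qed.

Lemma tens_ke : tens_k V W *m tens_e V W *m tens_ki V W = q *: tens_e V W.
Proof.
have KKK : w UK *m w UK *m w UKinv = w UK by rewrite -mulmxA smod_kki mulmx1.
have KSK : v UK *m S *m v UKinv = S by rewrite -Sk -mulmxA smod_kki mulmx1.
by rewrite eE kE kiE mulmxDr mulmxDl !tensmx_mul !smod_ke KKK KSK tensZl tensZr scalerDr.
Qed.

Lemma tens_kf : tens_k V W *m tens_f V W *m tens_ki V W = q^-1 *: tens_f V W.
Proof.
have KSK : v UK *m (v UKinv *m S) *m v UKinv = v UKinv *m S.
  by rewrite mulmxA smod_kki mul1mx Ski.
rewrite fE kE kiE mulmxDr mulmxDl !tensmx_mul !smod_kf KSK mulmx1 smod_kki.
by rewrite tensZl tensZr scalerDr.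
Qed.

Lemma tens_kki : tens_k V W *m tens_ki V W = 1%:M.
Proof. by rewrite kE kiE tensmx_mul !smod_kki tens1. Qed.

Lemma tens_kik : tens_ki V W *m tens_k V W = 1%:M.
Proof. by rewrite kE kiE tensmx_mul !smod_kik tens1. Qed.

Let homo_tens b c A B : homogeneous (smod_par V) b A ->
  homogeneous (smod_par W) c B -> homogeneous (tens_par V W) (b (+) c) (A *t B).
Proof.
move=> hA hB i j; case: (mxtens_indexP i) => i0 i1; case: (mxtens_indexP j) => j0 j1.
rewrite tensmxE mulf_eq0 negb_or => /andP[/hA <- /hB <-].
by rewrite /tens_par !mxtens_indexK addbACA.
Qed.

Let homo_S : homogeneous (smod_par V) false S.
Proof.
move=> i j; rewrite !mxE; case: (eqVneq i j) => [->|_]; first by rewrite addbb.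
by rewrite mulr0n eqxx.
Qed.

Let homo1 k (par : 'I_k -> bool) : homogeneous par false (1%:M : 'M[C]_k).
Proof.
move=> i j; rewrite !mxE; case: (eqVneq i j) => [->|_]; first by rewrite addbb.
by rewrite mulr0n eqxx.
Qed.

Let homoD k (par : 'I_k -> bool) b (A B : 'M[C]_k) :
  homogeneous par b A -> homogeneous par b B -> homogeneous par b (A + B).
Proof.
move=> hA hB i j; rewrite mxE; have [A0|/hA //] := eqVneq (A i j) 0.
by rewrite A0 add0r => /hB.
Qed.

Let homoM k (par : 'I_k -> bool) b c (A B : 'M[C]_k) :
  homogeneous par b A -> homogeneous par c B -> homogeneous par (b (+) c) (A *m B).
Proof.
move=> hA hB i j; rewrite mxE => ABij; apply/eqP; apply: contraNT ABij => pij.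
rewrite big1 // => k' _; apply/eqP; rewrite mulf_eq0; apply: contraNT pij.
by rewrite negb_or => /andP[/hA <- /hB <-]; rewrite addbA addbK.
Qed.

Lemma tens_homo x : homogeneous (tens_par V W) (ugen_par x)
  (match x with Ue => tens_e V W | Uf => tens_f V W
              | UK => tens_k V W | UKinv => tens_ki V W end).
Proof.
case: x.
- rewrite eE; apply: homoD.
    by apply: (@homo_tens true false); [exact: (@smod_homo _ V Ue)|exact: (@smod_homo _ W UK)].
  by apply: (@homo_tens false true); [exact: homo_S|exact: (@smod_homo _ W Ue)].
- rewrite fE; apply: homoD.
    by apply: (@homo_tens true false); [exact: (@smod_homo _ V Uf)|exact: homo1].
  apply: (@homo_tens false true); last exact: (@smod_homo _ W Uf).
  by apply: (@homoM _ _ false false); [exact: (@smod_homo _ V UKinv)|exact: homo_S].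
- by rewrite kE; apply: (@homo_tens false false); [exact: (@smod_homo _ V UK)|exact: (@smod_homo _ W UK)].
- by rewrite kiE; apply: (@homo_tens false false); [exact: (@smod_homo _ V UKinv)|exact: (@smod_homo _ W UKinv)].
Qed.

Definition tens_smod : smod (m * n) :=
  mk_smod tens_ef tens_ke tens_kf tens_kki tens_kik tens_homo.

End TensorModuleProofs.

(* The trivial module C (purely even; e, f act by 0 and K by 1), taken as the
   0-th tensor power; V (x) C is V itself, since 2 * 1 computes to 2. *)
Section TrivialModule.

Let homo_triv x : homogeneous (fun _ : 'I_1 => false) (ugen_par x)
  (match x with Ue | Uf => 0 | UK | UKinv => 1%:M end : 'M[C]_1).
Proof. by case: x => i j /=; rewrite !ord1 !mxE ?eqxx. Qed.

Let z : 'M[C]_1 := 0.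
Let triv_ef : z *m z + z *m z = (q - q^-1)^-1 *: (1%:M - 1%:M).
Proof. by rewrite subrr scaler0 mulmx0 addr0. Qed.
Let triv_0 c : 1%:M *m z *m 1%:M = c *: z.
Proof. by rewrite mulmx0 mul0mx scaler0. Qed.
Let triv_1 : 1%:M *m 1%:M = 1%:M :> 'M[C]_1. Proof. exact: mulmx1. Qed.

Definition triv_smod : smod 1 :=
  mk_smod triv_ef (triv_0 _) (triv_0 _) triv_1 triv_1 homo_triv.

End TrivialModule.

(* The module V^+_{1/2}.  Index 0 stands for the even highest weight vector
   v_{1/2} = v_+ and index 1 for v_{-1/2} = f v_+.  The weight of v_+ is
   kap = i q^(1/2); then K f v_+ = q^-1 kap (f v_+), and
   e f v_+ = (K - K^-1)/(q - q^-1) v_+ because e v_+ = 0. *)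
Section HalfModule.

Definition half_kap : C := 'i * qpow phi (1 / 2).

Definition half_par (a : 'I_2) : bool := a == 1.
Definition half_e : 'M[C]_2 :=
  ((half_kap - half_kap^-1) / (q - q^-1)) *: delta_mx 0 1.
Definition half_f : 'M[C]_2 := delta_mx 1 0.
Definition half_k : 'M[C]_2 :=
  diag_mx (\row_a (if a == 0 then half_kap else q^-1 * half_kap)).
Definition half_ki : 'M[C]_2 :=
  diag_mx (\row_a (if a == 0 then half_kap^-1 else q * half_kap^-1)).

Lemma half_kap_sqr : half_kap ^+ 2 = - q.
Proof.
rewrite exprMn sqrCi expr2 mulN1r -cexpD; congr (- cexp _).
by field.
Qed.

Lemma half_kap_neq0 : half_kap != 0.
Proof. by rewrite mulf_neq0 ?neq0Ci ?cexp_neq0. Qed.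

Lemma half_ef : half_e *m half_f + half_f *m half_e =
  (q - q^-1)^-1 *: (half_k - half_ki).
Proof.
have k0 := half_kap_neq0; have q0 := q_neq0.
have kap1 : q^-1 * half_kap = - half_kap^-1.
  by apply: (mulfI q0); rewrite mulVKf // mulrN -[q]opprK -half_kap_sqr expr2 mulNr opprK mulfK.
have kap2 : q * half_kap^-1 = - half_kap.
  by rewrite -[q]opprK -half_kap_sqr expr2 mulNr mulfK.
rewrite -scalemxAl -scalemxAr !mul_delta_mx -scalerDr mulrC -scalerA; congr (_ *: _).
apply/matrixP => a b; rewrite !mxE kap1 kap2.
case: a => [[|[|//]] ?]; case: b => [[|[|//]] ?] /=; rewrite ?(mulr0n, mulr1n, addr0, add0r, subr0, subrr) //.
- by rewrite mulr1.
- by rewrite mulr0 oppr0.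
- by rewrite mulr0 oppr0.
- by rewrite mulr1 opprK addrC.
Qed.

Lemma half_ke : half_k *m half_e *m half_ki = q *: half_e.
Proof.
have k0 := half_kap_neq0; have q0 := q_neq0.
rewrite mul_diag_mx mul_mx_diag; apply/matrixP => a b; rewrite !mxE.
case: a => [[|[|//]] ?]; case: b => [[|[|//]] ?] /=; rewrite ?(mulr0, mul0r) //.
by rewrite mulr1 mulrAC [q * _]mulrC mulVKf.
Qed.

Lemma half_kf : half_k *m half_f *m half_ki = q^-1 *: half_f.
Proof.
have k0 := half_kap_neq0; have q0 := q_neq0.
rewrite mul_diag_mx mul_mx_diag; apply/matrixP => a b; rewrite !mxE.
case: a => [[|[|//]] ?]; case: b => [[|[|//]] ?] /=; rewrite ?(mulr0, mul0r) //.
by rewrite !mulr1 mulfK.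
Qed.

Lemma half_kki : half_k *m half_ki = 1%:M.
Proof.
have k0 := half_kap_neq0; have q0 := q_neq0.
rewrite mul_diag_mx; apply/matrixP => a b; rewrite !mxE.
case: a => [[|[|//]] ?]; case: b => [[|[|//]] ?] /=; rewrite ?(mulr0n, mulr1n, mulr0) //.
  by rewrite mulfV.
by rewrite mulrACA !(mulVf, mulfV) // mulr1.
Qed.

Lemma half_kik : half_ki *m half_k = 1%:M.
Proof. by apply: mulmx1C; exact: half_kki. Qed.

Lemma half_homo x : homogeneous half_par (ugen_par x)
  (match x with Ue => half_e | Uf => half_f | UK => half_k | UKinv => half_ki end).
Proof.
case: x => a b; rewrite /half_par !mxE; case: a => [[|[|//]] ?]; case: b => [[|[|//]] ?] //=;
  by rewrite ?(mulr0n, mulr0) eqxx.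
Qed.

Definition half_smod : smod 2 :=
  mk_smod half_ef half_ke half_kf half_kki half_kik half_homo.

End HalfModule.

Fixpoint dimV (t : nat) : nat := if t is s.+1 then (2 * dimV s)%N else 1%N.

(* By coassociativity the bracketing V (x) (V (x) (...)) is immaterial. *)
Fixpoint Vpow (t : nat) : smod (dimV t) :=
  match t with
  | 0 => triv_smod
  | s.+1 => tens_smod half_smod (Vpow s)
  end.

Definition pi_half (x : uq) : 'M[C]_2 := smod_act half_smod x.

(* The label j of the basis vector v_j. *)
Definition spin (a : 'I_2) : C := if a == 0 then 1 / 2 else - (1 / 2).

Definition pi2phi : C := (pi : R)%:C%C / (2 * phi).

(* The basis v_a (x) v_b of V (x) V is indexed by mxtens_index (a, b), i.e. by
   2 a + b, so it comes in the usual lexicographic order. *)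
Definition Rtilde : 'M[C]_(2 * 2) :=
  1%:M + (q^-1 - q) *:
    stens (smod_par half_smod) true (pi_half (uq_gen Ue)) (pi_half (uq_gen Uf)).

Definition Ediag : 'M[C]_(2 * 2) :=
  diag_mx (\row_k qpow phi ((spin (mxtens_unindex k).1 + pi2phi) *
                            (spin (mxtens_unindex k).2 + pi2phi))).

Definition Pflip : 'M[C]_(2 * 2) :=
  \matrix_(k, l)
    ((-1) ^+ (smod_par half_smod (mxtens_unindex l).1 &&
              smod_par half_smod (mxtens_unindex l).2) *+
     (k == mxtens_index ((mxtens_unindex l).2, (mxtens_unindex l).1))).

Definition Rcheck : 'M[C]_(2 * 2) := Pflip *m Ediag *m Rtilde.

Lemma dimV_split (t : nat) (j : 'I_t.-1) :
  (dimV j * (2 * 2) * dimV (t - j.+2) = dimV t)%N.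
Proof.
have dE s : dimV s = (2 ^ s)%N by elim: s => //= s ->; rewrite expnS.
have jt : (j.+2 <= t)%N by case: t j => [[]|t j] //=; rewrite ltnS; exact: ltn_ord.
by rewrite !dE -[(2 * 2)%N]/(2 ^ 2)%N -!expnD addn2 subnKC.
Qed.

(* id^(x)j (x) X (x) id^(x)(t - j - 2), for 0 <= j < t - 1. *)
Definition at_pos (t : nat) (j : 'I_t.-1) (X : 'M[C]_(2 * 2)) : 'M[C]_(dimV t) :=
  castmx (dimV_split j, dimV_split j)
    ((1%:M : 'M[C]_(dimV j)) *t X *t (1%:M : 'M[C]_(dimV (t - j.+2)))).

Definition Rop (t : nat) (j : 'I_t.-1) : 'M[C]_(dimV t) := at_pos j Rcheck.
Definition Rop_inv (t : nat) (j : 'I_t.-1) : 'M[C]_(dimV t) :=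
  at_pos j (invmx Rcheck).

(* No parity condition is imposed on the endomorphisms. *)
Definition EndU (t : nat) : set 'M[C]_(dimV t) :=
  [set A | forall x : uq, A *m smod_act (Vpow t) x = smod_act (Vpow t) x *m A].

Definition is_subalgebra n (S : set 'M[C]_n) : Prop :=
  [/\ S 1%:M,
      forall (a : C) A B, S A -> S B -> S (a *: A + B) &
      forall A B, S A -> S B -> S (A *m B)].

Definition Ct (t : nat) : set 'M[C]_(dimV t) :=
  smallest (@is_subalgebra (dimV t))
    ([set Rop j | j in setT] `|` [set Rop_inv j | j in setT]).

Lemma PflipK : Pflip *m Pflip = 1%:M.
Proof.
apply/matrixP => k l; rewrite !mxE.
case: (mxtens_indexP k) => a b; case: (mxtens_indexP l) => c d.
rewrite (bigD1 (mxtens_index (d, c))) //= big1 => [|m ml]; last first.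
  by rewrite !mxE !mxtens_indexK (negPf ml) mulr0n mulr0.
rewrite !mxE !mxtens_indexK eqxx mulr1n addr0.
rewrite [smod_par _ d && _]andbC; case: (_ && _); case: (_ == _);
  by rewrite ?(mulr0n, mulr1n, mul0r, mulrNN, mulr1).
Qed.

Let coef : C := (half_kap - half_kap^-1) / (q - q^-1).
Let i1 : 'I_(2 * 2) := mxtens_index (0, 1).
Let i2 : 'I_(2 * 2) := mxtens_index (1, 0).

Lemma RtildeE : Rtilde = 1%:M - ((q^-1 - q) * coef) *: delta_mx i1 i2.
Proof.
rewrite /Rtilde /pi_half !mk_smodE -scalerA -scalerN; congr (_ + _ *: _).
apply/matrixP => k l; rewrite /stens mul_mx_diag !mxE /i1 /i2.
case: (mxtens_indexP k) => a b; case: (mxtens_indexP l) => c d.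
rewrite !mxtens_indexK !(can_eq (@mxtens_indexK 2 2)) !xpair_eqE /= /half_par.
case: a => [[|[|//]] ?]; case: b => [[|[|//]] ?];
case: c => [[|[|//]] ?]; case: d => [[|[|//]] ?] //=;
  by rewrite ?(mulr0, mul0r, mulr1, oppr0, expr1, mulrN1).
Qed.

Lemma Rtilde_unit : Rtilde \in unitmx.
Proof.
have D0 : delta_mx i1 i2 *m delta_mx i1 i2 = 0 :> 'M[C]_(2 * 2).
  by rewrite mul_delta_mx_0.
set x := ((q^-1 - q) * coef).
have : Rtilde *m (1%:M + x *: delta_mx i1 i2) = 1%:M.
  rewrite RtildeE mulmxDr mulmx1 mulmxBl mul1mx -scalemxAl -scalemxAr D0.
  by rewrite !scaler0 subr0 subrK.
by move=> /mulmx1_unit -[H _]; exact: H.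
Qed.

Lemma Rcheck_unit : Rcheck \in unitmx.
Proof.
rewrite !unitmx_mul Rtilde_unit andbT; apply/andP; split.
  by have [] := mulmx1_unit PflipK.
rewrite unitmxE det_diag unitfE prodf_seq_neq0; apply/allP => k _ /=.
by rewrite mxE; exact: cexp_neq0.
Qed.

Lemma RcheckE : phi != 0 -> q ^+ 2 != 1 ->
  Rcheck = ipow pi2phi *: \matrix_(k, l) nth 0 (nth [::] [::
    [:: 'i * qpow phi (1/4); 0; 0; 0];
    [:: 0; 0; qpow phi (- (1/4)); 0];
    [:: 0; qpow phi (- (1/4)); 'i * (qpow phi (1/4) + qpow phi (- (3/4))); 0];
    [:: 0; 0; 0; 'i * qpow phi (1/4)]] k) l.
Proof.
move=> phi0 q1.
have qh : qpow phi pi2phi = 'i.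
  rewrite /qpow /pi2phi (_ : 'i * _ * phi = (0 +i* (pi / 2))%C); last first.
    rewrite -complexiE; transitivity ('i%C * (pi / 2 : R)%:C%C : C).
      rewrite rmorphM fmorphV rmorph_nat.
      by field; rewrite phi0.
    by apply/eqP; rewrite eq_complex /=; apply/andP; split; apply/eqP; ring.
  rewrite /cexp /= expR0 cos_pihalf sin_pihalf mul1r -complexiE //.
have qhh : qpow phi (pi2phi * pi2phi) = ipow pi2phi.
  by congr cexp; rewrite /pi2phi; field; rewrite phi0.
have qD a b : qpow phi (a + b) = qpow phi a * qpow phi b.
  by rewrite /qpow mulrDr mulrDl cexpD.
have qhN : qpow phi (- pi2phi) = - 'i.
  have : qpow phi (pi2phi + - pi2phi) = 1 by rewrite subrr /qpow mulr0 mul0r cexp0.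
  rewrite qD qh => /(congr1 ( *%R (- 'i))).
  by rewrite mulrA mulNr -expr2 sqrCi opprK mul1r mulr1.
set J := ipow pi2phi in qhh *.
have E00 : qpow phi ((1 / 2 + pi2phi) * (1 / 2 + pi2phi)) = J * ('i * qpow phi (1/4)).
  rewrite [X in qpow _ X = _](_ : _ = 1 / 4 + pi2phi + pi2phi * pi2phi); last by field.
  by rewrite !qD qh qhh; ring.
have E01 : qpow phi ((1 / 2 + pi2phi) * (- (1 / 2) + pi2phi)) = J * qpow phi (- (1/4)).
  rewrite [X in qpow _ X = _](_ : _ = - (1 / 4) + pi2phi * pi2phi); last by field.
  by rewrite !qD qhh; ring.
have E10 : qpow phi ((- (1 / 2) + pi2phi) * (1 / 2 + pi2phi)) = J * qpow phi (- (1/4)).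
  by rewrite mulrC.
have E11 : qpow phi ((- (1 / 2) + pi2phi) * (- (1 / 2) + pi2phi)) =
    - (J * ('i * qpow phi (1/4))).
  rewrite [X in qpow _ X = _](_ : _ = 1 / 4 - pi2phi + pi2phi * pi2phi); last by field.
  by rewrite !qD qhN qhh; ring.
have xE : ((q^-1 - q) * coef) * qpow phi (- (1 / 4)) =
    - ('i * (qpow phi (1/4) + qpow phi (- (3/4)))).
  have qq : q - q^-1 != 0.
    apply: contraNneq q1 => /eqP; rewrite subr_eq0 => /eqP qq.
    by rewrite expr2 {1}qq mulVf ?q_neq0.
  have -> : (q^-1 - q) * coef = half_kap^-1 - half_kap.
    by rewrite /coef -[q^-1 - q]opprB mulNr mulrC divfK // opprB.
  have -> : half_kap^-1 = - 'i * qpow phi (- (1/2)).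
    apply: (mulfI half_kap_neq0); rewrite mulfV ?half_kap_neq0 //.
    rewrite /half_kap mulrACA -qD subrr /qpow mulr0 mul0r cexp0 mulr1.
    by rewrite mulrN -expr2 sqrCi opprK.
  rewrite mulrBl -mulrA -qD /half_kap -mulrA -qD.
  rewrite (_ : - (1 / 2) + - (1 / 4) = - (3 / 4)); last by field.
  rewrite (_ : 1 / 2 - (1 / 4) = 1 / 4); last by field.
  by ring.
have PEE a b c d : (Pflip *m Ediag) (mxtens_index (a, b)) (mxtens_index (c, d)) =
    ((-1) ^+ (half_par c && half_par d) *+ ((a == d) && (b == c))) *
    qpow phi ((spin c + pi2phi) * (spin d + pi2phi)).
  rewrite mul_mx_diag mxE [Pflip _ _]mxE [X in _ * X]mxE !mxtens_indexK.
  by rewrite (can_eq (@mxtens_indexK 2 2)) xpair_eqE.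
have RE k l : Rcheck k l = (Pflip *m Ediag) k l -
    ((q^-1 - q) * coef) * ((Pflip *m Ediag) k i1 *+ (l == i2)).
  rewrite /Rcheck RtildeE mulmxBr mulmx1 -scalemxAr.
  set M := Pflip *m Ediag; rewrite mxE [X in _ + X]mxE [X in _ - X]mxE; congr (_ - _ * _).
  rewrite mxE (bigD1 i1) //= big1 => [|m /negPf m1]; last by rewrite [delta_mx _ _ _ _]mxE m1 mulr0.
  by rewrite [delta_mx _ _ _ _]mxE eqxx addr0 mulr_natr.
apply/matrixP => k l; rewrite RE [RHS]mxE [X in _ = _ * X]mxE.
case: (mxtens_indexP k) => a b; case: (mxtens_indexP l) => c d.
rewrite /i1 /i2 !PEE (can_eq (@mxtens_indexK 2 2)) xpair_eqE /half_par /spin.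
case: a => [[|[|//]] ?]; case: b => [[|[|//]] ?];
case: c => [[|[|//]] ?]; case: d => [[|[|//]] ?] /=;
  rewrite ?(E00, E01, E10, E11) ?(mulr0n, mulr1n, expr0, expr1, mul0r, mulr0, mul1r, subr0,
            mulN1r, opprK) //.
move: xE; rewrite !mul1r => xE.
by rewrite sub0r mulrCA xE mulrN opprK.
Qed.

End Uq.

Arguments EndU {R} phi t _.
Arguments Ct {R} phi t _.

(* Main.v *)
Require Import Defs.
From HB Require Import structures.
From mathcomp Require Import all_boot all_order all_algebra.
From mathcomp Require Import complex mxtens.
From mathcomp Require Import boolp classical_sets reals sequences exp trigo.
From mathcomp Require Import ring.

Set Implicit Arguments.
Unset Strict Implicit.
Unset Printing Implicit Defensive.

Import Order.TTheory GRing.Theory Num.Theory.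
Local Open Scope classical_set_scope.
Local Open Scope ring_scope.

(* Put kap = i q^(1/2), so that kap^2 = -q, and let
   u = kap v_+ (x) v_- - v_- (x) v_+.  The rescaled braiding
   i^(1 - pi/2phi) q^(3/4) Rcheck is -(q + T) with T = u u^T of rank one.
   Since u^T u = 1 - q, and contracting one leg of u with the opposite leg of a
   second copy of u gives -kap, the operators T_j satisfy the Temperley-Lieb
   relations T_j^2 = (1 - q) T_j and T_j T_k T_j = -q T_j for |j - k| = 1; these
   give the Hecke relations for -(q + T_j).  Equivariance holds because u spans
   a one-dimensional submodule of V (x) V, as does u^T in the dual. *)

(** * Kronecker products and their reassociation *)

Section TensorMatrices.
Variable C : comNzRingType.

Lemma tensmx1 m n : (1%:M : 'M[C]_m) *t (1%:M : 'M[C]_n) = 1%:M.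
Proof.
apply/matrixP=> i j; case: (mxtens_indexP i) => i0 i1.
case: (mxtens_indexP j) => j0 j1.
by rewrite tensmxE !mxE (can_eq (@mxtens_indexK m n)) xpair_eqE -natrM mulnb.
Qed.

Lemma castmx_mulmx m n (e : m = n) (A B : 'M[C]_m) :
  castmx (e, e) (A *m B) = castmx (e, e) A *m castmx (e, e) B.
Proof. by case: n / e; rewrite !castmx_id. Qed.

(** The lexicographic indices of (x, (y, z)) and ((x, y), z) have the same numerical value, so
    reassociating changes only the type of an index. *)
Lemma tensmxA m n p m' n' p' (A : 'M[C]_(m, m')) (B : 'M[C]_(n, n'))
    (D : 'M[C]_(p, p')) e e' :
  A *t (B *t D) = castmx (e, e') (A *t B *t D).
Proof.
apply/matrixP=> i j; case: (mxtens_indexP i) => a i'.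
case: (mxtens_indexP i') => b c.
case: (mxtens_indexP j) => a' j'; case: (mxtens_indexP j') => b' c'.
rewrite !tensmxE castmxE.
have assocE r s k (x : 'I_r) (y : 'I_s) (z : 'I_k) E :
    cast_ord E (mxtens_index (x, mxtens_index (y, z))) =
    mxtens_index (mxtens_index (x, y), z).
  by apply: val_inj; rewrite /= mulnDl mulnA addnA.
by rewrite !assocE !tensmxE mulrA.
Qed.

Lemma castmx_tensl m n p (A : 'M[C]_m) (B : 'M[C]_n) (e : m = p) e' :
  castmx (e, e) A *t B = castmx (e', e') (A *t B).
Proof. by case: p / e in e' *; rewrite !castmx_id. Qed.

Lemma castmx_tensr m n p (A : 'M[C]_m) (B : 'M[C]_n) (e : n = p) e' :
  A *t castmx (e, e) B = castmx (e', e') (A *t B).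
Proof. by case: p / e in e' *; rewrite !castmx_id. Qed.

End TensorMatrices.

(** * Operators acting on two adjacent tensor factors *)

Section AtPos.
Variable R : realType.
Local Notation C := R[i].

Lemma at_pos0 s (X : 'M[C]_(2 * 2)) (e : (2 * 2 * dimV s = dimV s.+2)%N) :
  @at_pos R s.+2 ord0 X = castmx (e, e) (X *t 1%:M).
Proof.
(* The right identity factor has size [dimV (s - 0)], which does not compute to [dimV s];
   generalizing [s - 0] to [k] makes the equality substitutable. *)
suff castE k (Ek : k = s) (e' : (1 * (2 * 2) * dimV k = dimV s.+2)%N) :
    castmx (e', e') ((1%:M : 'M[C]_1) *t X *t (1%:M : 'M[C]_(dimV k))) =
    castmx (e, e) (X *t 1%:M) by exact: castE (subn0 s) _.
have -> : (1%:M : 'M[C]_1) *t X = X.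
  by rewrite [LHS]tens_scalar1mx [LHS]castmx_id.
by subst k; rewrite (eq_irrelevance e e').
Qed.

(** With [at_pos0] this drives the inductions on the number of factors: a positive position peels
    off the leftmost factor, and position 0 is the base case. *)
Lemma at_posS s (j : 'I_s) (X : 'M[C]_(2 * 2)) :
  @at_pos R s.+2 (lift ord0 j) X = 1%:M *t @at_pos R s.+1 j X.
Proof.
suff castE n p N (e : (2 * n * (2 * 2) * p = 2 * N)%N)
    (e' : (n * (2 * 2) * p = N)%N) :
  castmx (e, e) ((1%:M : 'M[C]_(2 * n)) *t X *t (1%:M : 'M[C]_p)) =
  (1%:M : 'M[C]_2) *t
    castmx (e', e') ((1%:M : 'M[C]_n) *t X *t (1%:M : 'M[C]_p)).
  exact: castE.
subst N; have E : (2 * n * (2 * 2) = 2 * (n * (2 * 2)))%N by rewrite !mulnA.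
have E' : (2 * (n * (2 * 2)) * p = 2 * (n * (2 * 2) * p))%N by rewrite !mulnA.
rewrite castmx_id (tensmxA _ _ _ E' E') (tensmxA _ _ _ E E) tensmx1.
rewrite (castmx_tensl _ _ _ (congr1 (muln^~ p) E)) castmx_comp.
by congr (castmx (_, _) _); exact: eq_irrelevance.
Qed.

Lemma at_posM t (j : 'I_t.-1) (X Y : 'M[C]_(2 * 2)) :
  at_pos j (X *m Y) = at_pos j X *m at_pos j Y.
Proof. by rewrite /at_pos -castmx_mulmx !tensmx_mul !mul1mx. Qed.

Lemma at_pos1 t (j : 'I_t.-1) : at_pos j (1%:M : 'M[C]_(2 * 2)) = 1%:M.
Proof.
by rewrite /at_pos !tensmx1; case: _ / (dimV_split j); rewrite castmx_id.
Qed.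

Lemma at_posD t (j : 'I_t.-1) (X Y : 'M[C]_(2 * 2)) :
  at_pos j (X + Y) = at_pos j X + at_pos j Y.
Proof.
rewrite /at_pos tensDr tensDl.
by case: _ / (dimV_split j); rewrite !castmx_id.
Qed.

Lemma at_posZ t (j : 'I_t.-1) (a : C) (X : 'M[C]_(2 * 2)) :
  at_pos j (a *: X) = a *: at_pos j X.
Proof.
rewrite /at_pos tensZr tensZl.
by case: _ / (dimV_split j); rewrite !castmx_id.
Qed.

Lemma at_pos_far t (j k : 'I_t.-1) (X Y : 'M[C]_(2 * 2)) : (j.+1 < k)%N ->
  at_pos j X *m at_pos k Y = at_pos k Y *m at_pos j X.
Proof.
case: t j k => [|t] /=; first by case.
elim: t => [|t IHt] j k; first by case: j.
case: (unliftP ord0 k) => [{}k ->|->] //.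
case: (unliftP ord0 j) => [{}j ->|->] jk.
  by rewrite !at_posS !tensmx_mul !mulmx1 IHt.
(* Here the first position is 0 and the second at least 2, so the second operator is the identity on
   the first two factors. *)
case: t {j} IHt k jk => [|t] _ k; first by case: k.
case: (unliftP ord0 k) => [{}k ->|->] // _.
have e : (2 * 2 * dimV t.+1 = dimV t.+3)%N by rewrite -mulnA.
rewrite (at_pos0 _ e) !at_posS (tensmxA _ _ _ e e) tensmx1 -!castmx_mulmx.
by rewrite !tensmx_mul !mulmx1 !mul1mx.
Qed.

(** Reduces the braid relation to three factors. The products of [X1] and [X2] typecheck because
    both dimensions compute to 8. *)
Lemma at_pos_braid t (j k : 'I_t.-1) (X : 'M[C]_(2 * 2)) :
    let X1 := X *t (1%:M : 'M[C]_2) : 'M[C]_(2 * 2 * 2) in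
    let X2 := (1%:M : 'M[C]_2) *t X : 'M[C]_(2 * (2 * 2)) in
    X1 *m X2 *m X1 = X2 *m X1 *m X2 -> k = j.+1 :> nat ->
  at_pos j X *m at_pos k X *m at_pos j X =
  at_pos k X *m at_pos j X *m at_pos k X.
Proof.
move=> X1 X2 braid.
case: t j k => [|t] /=; first by case.
elim: t => [|t IHt] j k; first by case: j.
case: (unliftP ord0 k) => [{}k ->|->] //.
case: (unliftP ord0 j) => [{}j ->|->] jk.
  by rewrite !at_posS !tensmx_mul !mulmx1 IHt //; case: jk.
case: t {j} IHt k jk => [|t] _ k; first by case: k.
case: (unliftP ord0 k) => [{}k ->|->] // _.
have e1 : (2 * 2 * dimV t = dimV t.+2)%N by rewrite -mulnA.
have e2 : (2 * 2 * dimV t.+1 = dimV t.+3)%N by rewrite -mulnA.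
have e3 : (2 * (2 * 2 * dimV t) = dimV t.+3)%N by rewrite e1.
have e4 : (2 * (2 * 2) * dimV t = 2 * (2 * 2 * dimV t))%N by rewrite !mulnA.
have e5 : (2 * (2 * 2) * dimV t = dimV t.+3)%N by rewrite e4 e3.
have e6 : (2 * 2 * 2 * dimV t = 2 * 2 * (2 * dimV t))%N by rewrite !mulnA.
(* Both operators become a three-factor operator tensored with the identity, cast along the same
   [e5], so that the hypothesis on [X1] and [X2] applies under the cast. *)
have -> : at_pos (lift ord0 ord0 : 'I_t.+3.-1) X = castmx (e5, e5) (X2 *t 1%:M).
  rewrite at_posS (at_pos0 _ e1) (castmx_tensr _ _ _ e3).
  rewrite (tensmxA _ _ _ e4 e4) castmx_comp.
  by congr (castmx (_, _) _); exact: eq_irrelevance.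
have -> : at_pos (ord0 : 'I_t.+3.-1) X = castmx (e5, e5) (X1 *t 1%:M).
  rewrite (at_pos0 _ e2) -[dimV t.+1]/(2 * dimV t)%N -tensmx1.
  rewrite (tensmxA _ _ _ e6 e6) castmx_comp.
  by congr (castmx (_, _) _); exact: eq_irrelevance.
by rewrite -!castmx_mulmx !tensmx_mul !mulmx1 braid.
Qed.

End AtPos.

(** Every element of a presented algebra is the class of a term, so induction on terms descends to
    the quotient. *)
Lemma palg_ind (C : fieldType) (P : presentation C) (Q : palg P -> Prop) :
  (forall g, Q (pgenerator g)) -> (forall c, Q c%:A) ->
  (forall x y, Q x -> Q y -> Q (x + y)) ->
  (forall x y, Q x -> Q y -> Q (x * y)) ->
  forall x, Q x.
Proof.
move=> Qg Qc QD QM x; rewrite -(pi_repr x).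
elim: (repr x) => [g|c|r IHr s IHs|r IHr s IHs]; first exact: Qg.
- by rewrite (_ : pi_palg _ = c%:A) //; exact/esym/mulr1.
- by rewrite -paddE; exact: QD.
- by rewrite -pmulE; exact: QM.
Qed.

(** * Equivariance of operators on tensor powers *)

Section Equivariance.
Variables (R : realType) (phi : R[i]).
Local Notation C := R[i].

Definition commutes n (V : smod phi n) (A : 'M[C]_n) :=
  forall x, A *m smod_act V (uq_gen phi x) = smod_act V (uq_gen phi x) *m A.

(** The algebra elements whose action commutes with a fixed matrix form a subalgebra, so the four
    generators suffice. *)
Lemma EndU_gen t (A : 'M[C]_(dimV t)) :
  commutes (Vpow phi t) A -> EndU phi t A.
Proof.
move=> cA; elim/palg_ind => [g|c|x y Ax Ay|x y Ax Ay]; first exact: cA.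
- by rewrite linearZ rmorph1 -scalemxAl -scalemxAr mulmx1 mul1mx.
- by rewrite linearD mulmxDl mulmxDr Ax Ay.
- by rewrite rmorphM mulmxA Ax -mulmxA Ay mulmxA.
Qed.

Section Tensor.
Variables (m n : nat) (V : smod phi m) (W : smod phi n).
Local Notation v x := (smod_act V (uq_gen phi x)).
Local Notation w x := (smod_act W (uq_gen phi x)).
Local Notation S := (sgn_op R (smod_par V) true).
Local Notation VW x := (smod_act (tens_smod V W) (uq_gen phi x)).

Lemma tens_actE :
  [/\ VW Ue = v Ue *t w UK + S *t w Ue,
      VW Uf = v Uf *t 1%:M + (v UKinv *m S) *t w Uf,
      VW UK = v UK *t w UK & VW UKinv = v UKinv *t w UKinv].
Proof.
by split; rewrite mk_smodE /tens_e /tens_f /tens_k /tens_ki /stens sgn_op0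
  ?mulmx1 ?mul1mx.
Qed.

Lemma commutes_tens1l A : commutes W A -> commutes (tens_smod V W) (1%:M *t A).
Proof.
move=> cA; have [aE fE kE kiE] := tens_actE.
by case; rewrite ?aE ?fE ?kE ?kiE ?(mulmxDl, mulmxDr) !tensmx_mul
  ?(mul1mx, mulmx1) ?cA.
Qed.

End Tensor.

(** After reassociation e acts as (e on V (x) V) (x) K + (S (x) S) (x) e. Besides the action on V
    (x) V, [X] must therefore commute with the parity operator S (x) S, that is, be even. *)
Lemma commutes_tens1r m n (V : smod phi m) (W : smod phi n)
    (X : 'M[C]_(m * m)) e :
  let S := sgn_op R (smod_par V) true in
  commutes (tens_smod V V) X -> X *m (S *t S) = (S *t S) *m X ->
  commutes (tens_smod V (tens_smod V W))
    (castmx (e, e) (X *t (1%:M : 'M[C]_n))).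
Proof.
move=> S cX cS; have [eE fE kE kiE] := tens_actE V (tens_smod V W).
have [eE1 fE1 kE1 kiE1] := tens_actE V W.
have [eE2 fE2 kE2 kiE2] := tens_actE V V.
(* This operator multiplies the action of f on W in the reassociated coproduct of f. It factors as
   the action of K^-1 on V (x) V times S (x) S. *)
have cKS : X *m ((smod_act V (uq_gen phi UKinv) *m S) *t
                 (smod_act V (uq_gen phi UKinv) *m S)) =
    ((smod_act V (uq_gen phi UKinv) *m S) *t
     (smod_act V (uq_gen phi UKinv) *m S)) *m X.
  by rewrite -tensmx_mul mulmxA -kiE2 cX kiE2 -mulmxA cS mulmxA.
have A3 := tensmxA _ _ _ e e.
have castD (M N : 'M_(m * m * n)) :
    castmx (e, e) M + castmx (e, e) N = castmx (e, e) (M + N).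
  by case: _ / (e); rewrite !castmx_id.
case; rewrite ?(eE, fE, kE, kiE) ?(eE1, fE1, kE1, kiE1) -?tensmx1 ?tensDr !A3;
  rewrite ?castD -!castmx_mulmx; congr (castmx _ _).
- rewrite addrA -tensDl -eE2 mulmxDl mulmxDr !tensmx_mul.
  by rewrite ?(mul1mx, mulmx1) cX cS.
- rewrite addrA -tensDl -fE2 mulmxDl mulmxDr !tensmx_mul.
  by rewrite ?(mul1mx, mulmx1) cX cKS.
- by rewrite -kE2 !tensmx_mul ?(mul1mx, mulmx1) cX.
- by rewrite -kiE2 !tensmx_mul ?(mul1mx, mulmx1) cX.
Qed.

Lemma commutes_at_pos t (j : 'I_t.-1) (X : 'M[C]_(2 * 2)) :
  let S := sgn_op R (smod_par (half_smod phi)) true in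
  commutes (tens_smod (half_smod phi) (half_smod phi)) X ->
  X *m (S *t S) = (S *t S) *m X ->
  commutes (Vpow phi t) (at_pos j X).
Proof.
move=> S cX cS; case: t j => [|t] /=; first by case.
elim: t => [|t IHt] j; first by case: j.
case: (unliftP ord0 j) => [{}j ->|->].
  by rewrite at_posS; apply: commutes_tens1l; exact: IHt.
have e : (2 * 2 * dimV t = dimV t.+2)%N by rewrite -mulnA.
by rewrite (at_pos0 _ e); exact: commutes_tens1r.
Qed.

End Equivariance.

(** * The singlet vector and the equivariance of T *)

Section HalfBraiding.
Variables (R : realType) (phi : R[i]).
Local Notation C := R[i].
Local Notation q := (qpar phi).
Local Notation kap := (half_kap phi).
Local Notation V := (half_smod phi).
Local Notation v x := (smod_act V (uq_gen phi x)).
Local Notation S := (sgn_op R (smod_par V) true).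
Local Notation vp := (delta_mx 0 0 : 'cV[C]_2).
Local Notation vm := (delta_mx 1 0 : 'cV[C]_2).

(* The same matrix as [a *t b], at the type ['cV_(2 * 2)] instead of
   ['M_(2 * 2, 1 * 1)]. *)
Definition tensv (a b : 'cV[C]_2) : 'cV[C]_(2 * 2) := a *t b.

Lemma tensv_mul (A B : 'M[C]_2) a b :
  (A *t B) *m tensv a b = tensv (A *m a) (B *m b).
Proof. exact: (@tensmx_mul _ 2 2 2 2 1 1). Qed.

Lemma tensvZl c a b : tensv (c *: a) b = c *: tensv a b.
Proof. exact: (@tensZl _ 2 1 2 1). Qed.

Lemma tensvZr c a b : tensv a (c *: b) = c *: tensv a b.
Proof. exact: (@tensZr _ 2 1 2 1). Qed.

Lemma tensvNl a b : tensv (- a) b = - tensv a b.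
Proof. exact: (@tensNl _ 2 1 2 1). Qed.

Lemma tensvNr a b : tensv a (- b) = - tensv a b.
Proof. exact: (@tensNr _ 2 1 2 1). Qed.

Lemma tensv0l b : tensv 0 b = 0.
Proof. exact: (@tens0mx _ 2 1 2 1). Qed.

Lemma tensv0r a : tensv a 0 = 0.
Proof. exact: (@tensmx0 _ 2 1 2 1). Qed.

Definition singlet : 'cV[C]_(2 * 2) := kap *: tensv vp vm - tensv vm vp.

Definition TLop : 'M[C]_(2 * 2) := singlet *m singlet^T.

(** This is the weight of v_-. The weights of v_+ and v_- thus multiply to -1, which is the
    eigenvalue of K on the singlet. *)
Lemma kapV : q^-1 * kap = - kap^-1.
Proof.
have k0 := half_kap_neq0 phi; have q0 := q_neq0 phi.
apply: (mulfI q0); rewrite mulVKf // mulrN -[q]opprK -half_kap_sqr.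
by rewrite expr2 mulNr opprK mulfK.
Qed.

Lemma half_act_vp : [/\ v Ue *m vp = 0, v Uf *m vp = vm, v UK *m vp = kap *: vp,
  v UKinv *m vp = kap^-1 *: vp & S *m vp = vp].
Proof.
rewrite !mk_smodE; split.
- by rewrite -scalemxAl mul_delta_mx_0 ?scaler0.
- by rewrite mul_delta_mx.
- apply/matrixP => i j; rewrite mul_diag_mx !mxE.
  by case: i => [[|[|//]] ?] //=; rewrite ?mulr0.
- apply/matrixP => i j; rewrite mul_diag_mx !mxE.
  by case: i => [[|[|//]] ?] //=; rewrite ?mulr0.
- apply/matrixP => i j; rewrite mul_diag_mx !mxE.
  by case: i => [[|[|//]] ?] //=; rewrite ?mulr0 ?mul1r.
Qed.

Lemma half_act_vm : [/\ v Uf *m vm = 0, v UK *m vm = - kap^-1 *: vm,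
  v UKinv *m vm = - kap *: vm & S *m vm = - vm].
Proof.
have kapV' : q * kap^-1 = - kap.
  by rewrite -[q]opprK -half_kap_sqr expr2 mulNr mulfK ?half_kap_neq0.
rewrite !mk_smodE; split.
- by rewrite mul_delta_mx_0.
- apply/matrixP => i j; rewrite mul_diag_mx !mxE kapV.
  by case: i => [[|[|//]] ?] //=; rewrite ?mulr0.
- apply/matrixP => i j; rewrite mul_diag_mx !mxE kapV'.
  by case: i => [[|[|//]] ?] //=; rewrite ?mulr0.
- apply/matrixP => i j; rewrite mul_diag_mx !mxE.
  case: i => [[|[|//]] ?] //=; rewrite ?mulr0 ?oppr0 //.
  by rewrite expr1 mulN1r.
Qed.

Lemma half_act_tr : [/\ (v Ue)^T *m vp = ((kap - kap^-1) / (q - q^-1)) *: vm,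
  (v Ue)^T *m vm = 0, (v Uf)^T *m vp = 0 & (v Uf)^T *m vm = vp].
Proof.
rewrite !mk_smodE linearZ /= !trmx_delta; split.
- by rewrite -scalemxAl mul_delta_mx.
- by rewrite -scalemxAl mul_delta_mx_0 ?scaler0.
- by rewrite mul_delta_mx_0.
- by rewrite mul_delta_mx.
Qed.

Lemma half_act_sym : [/\ (v UK)^T = v UK, (v UKinv)^T = v UKinv & S^T = S].
Proof. by rewrite !mk_smodE !tr_diag_mx. Qed.

Lemma half_actE_vm : v Ue *m vm = ((kap - kap^-1) / (q - q^-1)) *: vp.
Proof. by rewrite mk_smodE -scalemxAl mul_delta_mx. Qed.

(** Since T A = u (A^T u)^T and A T = (A u) u^T, it suffices that u is an eigenvector of A and of
    A^T with the same eigenvalue. The eigenvalue is 0 for e and f, and -1 for K and K^-1. *)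
Lemma TLop_commutes : commutes (tens_smod V V) TLop.
Proof.
have [ep fp kp kip Sp] := half_act_vp; have [fm km kim Sm] := half_act_vm.
have em := half_actE_vm; have [tep tem tfp tfm] := half_act_tr.
have [tk tki tS] := half_act_sym.
have [eE fE kE kiE] := tens_actE V V.
have k0 := half_kap_neq0 phi.
have diagC (A : 'M_(2 * 2)) : A^T = A -> A *m singlet = - singlet ->
    TLop *m A = A *m TLop.
  move=> sA Au; rewrite /TLop mulmxA Au -mulmxA -{1}sA -trmx_mul Au.
  by rewrite linearN /= mulmxN mulNmx.
have nilC (A : 'M_(2 * 2)) : A *m singlet = 0 -> A^T *m singlet = 0 ->
    TLop *m A = A *m TLop.
  move=> Au uA; rewrite /TLop mulmxA Au -mulmxA -{1}[A]trmxK -trmx_mul uA.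
  by rewrite trmx0 mulmx0 mul0mx.
have trD (A B : 'M[C]_(2 * 2)) : (A + B)^T = A^T + B^T by exact: linearD.
case.
- rewrite eE; apply: nilC.
    rewrite /singlet mulmxBr -scalemxAr !mulmxDl !tensv_mul.
    rewrite ep em km kp Sp Sm.
    rewrite tensv0l tensv0r add0r addr0 !(tensvZl, tensvZr).
    by rewrite !scalerA [kap * _]mulrC subrr.
  rewrite trD !trmx_tens tk tS.
  rewrite /singlet mulmxBr -scalemxAr !mulmxDl !tensv_mul.
  rewrite tep tem km kp Sp Sm.
  rewrite tensv0l tensv0r !(addr0, add0r) !(tensvZl, tensvZr, tensvNl).
  (* Only v_- (x) v_- survives, with coefficient kap c (- kap^-1) + c = 0. *)
  move: (_ / _) (tensv _ _) => c w.
  by apply/colP => i; rewrite !mxE; field.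
- rewrite fE; apply: nilC.
    rewrite /singlet mulmxBr -scalemxAr !mulmxDl !tensv_mul -!mulmxA Sp Sm.
    rewrite mulmxN fp fm kip kim !mul1mx tensv0l tensv0r addr0 add0r.
    by rewrite !(tensvZl, tensvNl) scaleNr opprK subrr.
  rewrite trD !trmx_tens trmx_mul tki tS trmx1.
  rewrite /singlet mulmxBr -scalemxAr !mulmxDl !tensv_mul -!mulmxA tfp tfm.
  rewrite kip kim -scalemxAr Sp !mul1mx tensv0l tensv0r add0r addr0.
  by rewrite tensvZl scalerA mulfV // scale1r subrr.
- rewrite kE; apply: diagC; first by rewrite trmx_tens tk.
  rewrite /singlet mulmxBr -scalemxAr !tensv_mul kp km !(tensvZl, tensvZr).
  move: (tensv _ vm) (tensv vm _) => w w'.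
  by apply/colP => i; rewrite !mxE; field.
- rewrite kiE; apply: diagC; first by rewrite trmx_tens tki.
  rewrite /singlet mulmxBr -scalemxAr !tensv_mul kip kim !(tensvZl, tensvZr).
  move: (tensv _ vm) (tensv vm _) => w w'.
  by apply/colP => i; rewrite !mxE; field.
Qed.

(** The singlet is an odd vector, so S (x) S negates both u and u^T, and T = u u^T is even. *)
Lemma TLop_sgn : TLop *m (S *t S) = (S *t S) *m TLop.
Proof.
have [_ _ _ _ Sp] := half_act_vp; have [_ _ _ Sm] := half_act_vm.
have [_ _ tS] := half_act_sym.
have Su : (S *t S) *m singlet = - singlet.
  rewrite /singlet mulmxBr -scalemxAr !tensv_mul Sp Sm tensvNl tensvNr.
  by rewrite scalerN opprB opprK addrC.
rewrite /TLop mulmxA Su -mulmxA -[S *t S in LHS]trmxK trmx_tens tS.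
by rewrite -trmx_mul Su linearN /= mulmxN mulNmx.
Qed.

(** * Temperley-Lieb relations and the braid identity they imply *)

Lemma singletE :
  singlet = \col_k nth 0 [:: 0; kap; -1; 0] k.
Proof.
apply/colP => k; rewrite /singlet !mxE /=.
case: k => [[|[|[|[|//]]]] ?] /=;
 by rewrite !(mulr0, mulr1, mul0r, subr0, sub0r, oppr0).
Qed.

Lemma singlet_norm : singlet^T *m singlet = (1 - q)%:M.
Proof.
rewrite singletE; apply/matrixP => i j; rewrite !ord1 !mxE.
rewrite !big_ord_recl big_ord0 !mxE /= -half_kap_sqr mulr1n.
by ring.
Qed.

Lemma TLop_sqr : TLop *m TLop = (1 - q) *: TLop.
Proof.
rewrite /TLop mulmxA -(mulmxA singlet) singlet_norm mul_mx_scalar.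
by rewrite -scalemxAl.
Qed.

(** [sl] and [sr] are the maps from V to the triple tensor power that insert a singlet to the left
    or to the right of the given vector. *)
Local Notation sl := ((singlet : 'M[C]_(2 * 2, 1)) *t (1%:M : 'M[C]_2)
  : 'M[C]_(2 * 2 * 2, 2)).
Local Notation sr := ((1%:M : 'M[C]_2) *t (singlet : 'M[C]_(2 * 2, 1))
  : 'M[C]_(2 * 2 * 2, 2)).

(** Let U be the 2 x 2 coefficient matrix of u, with rows (0, kap) and (-1, 0). The (i, j) entry of
    the product is the (j, i) entry of U^2, and U^2 = - kap. *)
Lemma singlet_zigzag : sl^T *m sr = (- kap)%:M.
Proof.
rewrite singletE; apply/matrixP => i j; rewrite !mxE.
rewrite !big_ord_recl big_ord0 !mxE /=.
by case: i => [[|[|//]] ?]; case: j => [[|[|//]] ?] /=;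
  rewrite ?mulr1n ?mulr0n; ring.
Qed.

Local Notation TL1 := (TLop *t (1%:M : 'M[C]_2) : 'M[C]_(2 * 2 * 2)).
Local Notation TL2 := ((1%:M : 'M[C]_2) *t TLop : 'M[C]_(2 * (2 * 2))).

Lemma TL1E : TL1 = sl *m sl^T.
Proof.
rewrite [sl^T](@trmx_tens _ (2 * 2) 1 2 2) trmx1.
by rewrite [RHS](@tensmx_mul _ (2 * 2) 1 2 2 (2 * 2) 2) mulmx1.
Qed.

Lemma TL2E : TL2 = sr *m sr^T.
Proof.
rewrite [sr^T](@trmx_tens _ 2 2 (2 * 2) 1) trmx1.
by rewrite [RHS](@tensmx_mul _ 2 2 (2 * 2) 1 2 (2 * 2)) mulmx1.
Qed.

Lemma TLop_word :
  TL1 *m TL2 *m TL1 = - q *: TL1 /\ TL2 *m TL1 *m TL2 = - q *: TL2.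
Proof.
have lr := singlet_zigzag.
have rl : sr^T *m sl = (- kap)%:M.
  by rewrite -[sl in LHS]trmxK -trmx_mul lr tr_scalar_mx.
(* Regrouped as A (A^T B) (B^T A) A^T, the word has two scalar inner factors; here a = - kap, so a^2
   = - q. *)
have word m n (A B : 'M[C]_(m, n)) a : A^T *m B = a%:M -> B^T *m A = a%:M ->
    A *m A^T *m (B *m B^T) *m (A *m A^T) = a ^+ 2 *: (A *m A^T).
  move=> AB BA; rewrite !mulmxA -[A *m A^T *m B]mulmxA AB mul_mx_scalar.
  rewrite -[_ *m B^T *m A]mulmxA BA mul_mx_scalar -!scalemxAl scalerA.
  by rewrite expr2.
by rewrite TL1E TL2E -half_kap_sqr -sqrrN; split; apply: word.
Qed.

(** The right-hand side is symmetric in [x] and [y], so exchanging their roles yields the braid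
    relation. The coefficient of [x] is 2 a^2 + a (1 - a) - a = a^2. *)
Lemma braid_of_TL n (a : C) (x y : 'M[C]_n) :
  x *m x = (1 - a) *: x -> x *m y *m x = - a *: x ->
  (a%:M + x) *m (a%:M + y) *m (a%:M + x) =
  (a ^+ 3)%:M + a ^+ 2 *: (x + y) + a *: (x *m y + y *m x).
Proof.
move=> xx xyx; rewrite !(mulmxDl, mulmxDr) xyx.
rewrite !(mul_scalar_mx, mul_mx_scalar) -!scalemxAl mul_scalar_mx xx.
move: (x *m y) (y *m x) => w w'; rewrite -[a%:M]scalemx1 -[(a ^+ 3)%:M]scalemx1.
by move: 1%:M => I; apply/matrixP => i j; rewrite !mxE; ring.
Qed.

(** * Hecke relations for -(q + T), and its identification with the rescaled braiding *)

Definition hecke_op : 'M[C]_(2 * 2) := - (q%:M + TLop).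

Lemma hecke_op_braid :
  let G1 := hecke_op *t (1%:M : 'M[C]_2) : 'M[C]_(2 * 2 * 2) in
  let G2 := (1%:M : 'M[C]_2) *t hecke_op : 'M[C]_(2 * (2 * 2)) in
  G1 *m G2 *m G1 = G2 *m G1 *m G2.
Proof.
have [w12 w21] := TLop_word.
have qE : q%:M = q *: (1%:M : 'M[C]_(2 * 2)) by rewrite scalemx1.
have -> : hecke_op *t (1%:M : 'M[C]_2) = - (q%:M + TL1).
  by rewrite /hecke_op tensNl tensDl qE tensZl tensmx1 scalemx1.
have -> : (1%:M : 'M[C]_2) *t hecke_op = - (q%:M + TL2).
  by rewrite /hecke_op tensNr tensDr qE tensZr tensmx1 scalemx1.
move=> G1 G2; rewrite /G1 /G2 !mulNmx !mulmxN !mulNmx !opprK; congr (- _).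
rewrite !braid_of_TL //; first by rewrite [TL1 + _]addrC [_ *m TL2 + _]addrC.
  by rewrite tensmx_mul mulmx1 TLop_sqr tensZr.
by rewrite tensmx_mul mulmx1 TLop_sqr tensZl.
Qed.

(** With G = -(q + T) one has (G + q)(G + 1) = T^2 - (1 - q) T = 0. *)
Lemma hecke_op_quad : hecke_op *m hecke_op = (- q - 1) *: hecke_op + (- q)%:M.
Proof.
rewrite /hecke_op mulNmx mulmxN opprK mulmxDl !mulmxDr TLop_sqr.
rewrite !(mul_scalar_mx, mul_mx_scalar) -[q%:M]scalemx1 -[(- q)%:M]scalemx1.
by move: 1%:M TLop => I T; apply/matrixP => i j; rewrite !mxE; ring.
Qed.

Lemma Rcheck_hecke_op : phi != 0 -> q ^+ 2 != 1 ->
  (ipow (1 - pi2phi phi) * qpow phi (3 / 4)) *: Rcheck phi = hecke_op.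
Proof.
move=> phi0 q2; rewrite RcheckE // scalerA.
(* The powers of i combine to i^1 = e^(i pi / 2), which is evaluated through cos and sin of pi /
   2. *)
have -> : ipow (1 - pi2phi phi) * qpow phi (3 / 4) * ipow (pi2phi phi) =
    'i * qpow phi (3 / 4).
  rewrite mulrAC /ipow -cexpD; congr (_ * _).
  rewrite [X in cexp X](_ : _ = 'i * ((pi : R)%:C%C / 2)); last by field.
  rewrite (_ : 'i * _ = (0 +i* (pi / 2))%C); last first.
    transitivity ('i%C * (pi / 2 : R)%:C%C : C).
      by rewrite rmorphM fmorphV rmorph_nat.
    by apply/eqP; rewrite eq_complex /=; apply/andP; split; apply/eqP; ring.
  by rewrite /cexp /= expR0 cos_pihalf sin_pihalf mul1r -complexiE.
have qD a b : qpow phi (a + b) = qpow phi a * qpow phi b.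
  by rewrite /qpow mulrDr mulrDl cexpD.
have sqri : 'i * 'i = -1 :> C by rewrite -expr2 sqrCi.
have q1 : qpow phi (3 / 4) * qpow phi (1 / 4) = q.
  by rewrite -qD /qpow; congr cexp; field.
have qh : qpow phi (3 / 4) * qpow phi (- (1 / 4)) = qpow phi (1 / 2).
  by rewrite -qD; congr (qpow _ _); field.
have q0 : qpow phi (3 / 4) * qpow phi (- (3 / 4)) = 1.
  by rewrite -qD subrr /qpow mulr0 mul0r cexp0.
have Gcorner : 'i * qpow phi (3 / 4) * ('i * qpow phi (1 / 4)) = - q.
  by rewrite mulrACA sqri q1 mulN1r.
have Goff : 'i * qpow phi (3 / 4) * qpow phi (- (1 / 4)) = kap.
  by rewrite -mulrA qh.
have Gmid : 'i * qpow phi (3 / 4) *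
    ('i * (qpow phi (1 / 4) + qpow phi (- (3 / 4)))) = - (q + 1).
  by rewrite mulrACA sqri mulrDr q1 q0 mulN1r.
(* Accounts for the zero diagonal entry at v_+ (x) v_-, where -(q + T) has -(q + kap^2). *)
have kk : kap * kap = - q by rewrite -expr2 half_kap_sqr.
rewrite /hecke_op /TLop singletE; apply/matrixP => k l; rewrite !mxE big_ord1 !mxE.
by case: k => [[|[|[|[|//]]]] ?]; case: l => [[|[|[|[|//]]]] ?] /=;
  rewrite ?(Gcorner, Goff, Gmid, kk, mulr0n, mulr1n, mulr0, mul0r, addr0,
            add0r, mulrN1, mulN1r, opprK, subrr, oppr0).
Qed.

End HalfBraiding.

Lemma phi_neq0 (R : realType) (phi : R[i]) : qpar phi != 1 -> phi != 0.
Proof.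
by apply: contraNneq => ->; rewrite /qpar mulr0 cexp0.
Qed.

(** * The algebra generated by the braidings and the Hecke representation *)

Section HeckeRepresentation.
Variables (R : realType) (phi : R[i]).
Local Notation C := R[i].
Local Notation q := (qpar phi).
Hypotheses (phi0 : phi != 0) (q2 : q ^+ 2 != 1).
Local Notation c := (ipow (1 - pi2phi phi) * qpow phi (3 / 4)).

Lemma scaling_neq0 : c != 0.
Proof. by rewrite mulf_neq0 ?cexp_neq0. Qed.

Lemma Rop_hecke_op t (j : 'I_t.-1) : c *: Rop phi j = at_pos j (hecke_op phi).
Proof. by rewrite /Rop -at_posZ Rcheck_hecke_op. Qed.

(** The scaling factor is nonzero, so equivariance passes back from -(q + T) to the braiding
    itself. *)
Lemma EndU_Rop t (j : 'I_t.-1) : EndU phi t (Rop phi j).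
Proof.
have -> : Rop phi j = c^-1 *: at_pos j (hecke_op phi).
  by rewrite -Rop_hecke_op scalerA mulVf ?scale1r ?scaling_neq0.
have cG : commutes (Vpow phi t) (at_pos j (hecke_op phi)).
  apply: commutes_at_pos => [x|].
    by rewrite /hecke_op mulNmx mulmxN mulmxDl mulmxDr TLop_commutes scalar_mxC.
  by rewrite /hecke_op mulNmx mulmxN mulmxDl mulmxDr TLop_sgn scalar_mxC.
by move=> x; rewrite -scalemxAl -scalemxAr (EndU_gen cG).
Qed.

Lemma Rop_invE t (j : 'I_t.-1) :
  Rop_inv phi j *m Rop phi j = 1%:M /\ Rop phi j *m Rop_inv phi j = 1%:M.
Proof.
by rewrite /Rop /Rop_inv -!at_posM mulVmx ?mulmxV ?Rcheck_unit ?at_pos1.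
Qed.

Lemma EndU_inv t (A B : 'M[C]_(dimV t)) : A *m B = 1%:M -> B *m A = 1%:M ->
  EndU phi t A -> EndU phi t B.
Proof.
move=> AB BA cA x; rewrite -[RHS]mul1mx -BA -mulmxA (mulmxA A) cA.
by rewrite -mulmxA AB mulmx1.
Qed.

Lemma EndU_subalgebra t : is_subalgebra (EndU phi t).
Proof.
split=> [x|a A B cA cB x|A B cA cB x]; first by rewrite mul1mx mulmx1.
  by rewrite mulmxDl mulmxDr -scalemxAl -scalemxAr cA cB.
by rewrite -mulmxA cB !mulmxA cA.
Qed.

Lemma Ct_sub_EndU t : Ct phi t `<=` EndU phi t.
Proof.
apply: smallest_sub; first exact: EndU_subalgebra.
move=> _ [[j _ <-]|[j _ <-]]; first exact: EndU_Rop.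
have [VR RV] := Rop_invE j.
exact: EndU_inv RV VR (EndU_Rop j).
Qed.

Lemma Ct_subalgebra t : is_subalgebra (Ct phi t).
Proof.
split=> [S [[S1 _ _] _] //|a A B cA cB S SS|A B cA cB S SS].
  by case: (SS) => -[_ SD _] _; apply: SD; [exact: cA|exact: cB].
by case: (SS) => -[_ _ SM] _; apply: SM; [exact: cA|exact: cB].
Qed.

Lemma hecke_relP t r s : @hecke_rel C t (- q) r s ->
  eval (@scalar_mx C (dimV t)) (fun j => c *: Rop phi j) r =
  eval (@scalar_mx C (dimV t)) (fun j => c *: Rop phi j) s.
Proof.
case=> [j k jk|j k jk|j] /=; rewrite !Rop_hecke_op -!mulmxE.
- exact: at_pos_braid (hecke_op_braid phi) jk.
- by case/orP: jk => jk; [|apply/esym]; exact: at_pos_far.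
- rewrite -at_posM hecke_op_quad at_posD at_posZ mul_scalar_mx.
  by rewrite -[(- q)%:M]scalemx1 at_posZ at_pos1 scalemx1.
Qed.

End HeckeRepresentation.

Theorem lemma12p2 (R : realType) (phi : R[i])
    (hq : forall n : nat, (0 < n)%N -> qpar phi ^+ n != 1)
    (t : nat) (ht : (2 <= t)%N) :
  Ct phi t `<=` EndU phi t /\
  exists rho : {lrmorphism hecke t (- qpar phi) -> 'M[R[i]]_(dimV t)},
    (forall j : 'I_t.-1,
       rho (hecke_gen (- qpar phi) j) =
         (ipow (1 - pi2phi phi) * qpow phi (3 / 4)) *: Rop phi j) /\
    (forall x : hecke t (- qpar phi), Ct phi t (rho x)).
Proof.
(* Exponent 1 excludes phi = 0, so pi/(2 phi) is a genuine quotient. Exponent 2 makes q - q^-1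
   invertible. The explicit matrix of the braiding relies on both. *)
have phi0 : phi != 0 by apply: phi_neq0; exact: (hq 1%N).
have q2 := hq 2%N isT.
split; first exact: Ct_sub_EndU.
pose P := Presentation (hecke_aug t (- qpar phi)).
pose rho := @prep _ P _ _ (hecke_relP phi0 q2 (t := t)).
exists rho.
have rhoE j : rho (hecke_gen (- qpar phi) j) =
    (ipow (1 - pi2phi phi) * qpow phi (3 / 4)) *: Rop phi j by exact: prepE.
split=> // x.
have [C1 CD CM] := Ct_subalgebra phi t.
(* Closure is stated only for a A + B, so 0 is obtained as (-1) 1 + 1. *)
have C0 : Ct phi t 0 by have := CD (-1) _ _ C1 C1; rewrite scaleN1r addNr.
have CZ a A : Ct phi t A -> Ct phi t (a *: A).
  by move=> cA; rewrite -[_ *: _]addr0; exact: CD.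
elim/palg_ind: x => [j|a|x y cx cy|x y cx cy].
- rewrite [rho _]rhoE; apply: CZ => S [_]; apply; left; by exists j.
- by rewrite linearZ rmorph1; exact: CZ.
- by rewrite linearD; have := CD 1 _ _ cx cy; rewrite scale1r; exact.
- by rewrite rmorphM; exact: CM.
Qed.
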